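(* Let $(\mathcal X,\psi)$ be a Polish metric space, let $V:\mathcal X\to[0,\infty)$ be continuous, and let $\alpha\in(0,1)$ and $A>0$. Let $d_{\alpha,A}$ be the path metric associated with the cost $c_{\alpha,A}(x,y)=\psi(x,y)^\alpha\{A+V(x)+V(y)\}^{1-\alpha}$. If $\mu,\nu$ are Borel probability measures on $\mathcal X$ with $\mu(V)<\infty$ and $\nu(V)<\infty$, then $$W_{d_{\alpha,A}}(\mu,\nu)\le\{A+\mu(V)+\nu(V)\}^{1-\alpha}\,W_\psi(\mu,\nu)^\alpha .$$
   Context: Polish metric space: complete separable metric space. The path metric is $$d_{\alpha,A}(x,y):=\inf_{m\ge1}\ \inf_{x=z_0,z_1,\ldots,z_m=y}\ \sum_{i=1}^m c_{\alpha,A}(z_{i-1},z_i),$$ the inner infimum being over all finite sequences $z_0,\dots,z_m$ in $\mathcal X$ from $x$ to $y$. (It is a metric generating the same topology and Borel sets as $\psi$.) For a metric $d$, $W_d(\mu,\nu)=\inf_\Gamma\int d(x,y)\,\Gamma(dx,dy)$ over all couplings $\Gamma$ of $\mu$ and $\nu$ (possibly $+\infty$). $\mu(V)=\int V\,d\mu$. *)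

(* Defs.v *)
From HB Require Import structures.
From mathcomp Require Import all_boot all_order all_algebra.
From mathcomp Require Import all_classical all_reals all_analysis.

Set Implicit Arguments.
Unset Strict Implicit.
Unset Printing Implicit Defensive.

Import Order.TTheory GRing.Theory Num.Theory.
Import numFieldNormedType.Exports.

Local Open Scope classical_set_scope.
Local Open Scope ring_scope.

(* Complete types and measurable types are pointed in the library; nothing is
   lost, since an empty space carries no probability measure. *)
#[short(type="completeMetricType")]
HB.structure Definition CompleteMetric (R : numDomainType) :=
  {T of Metric R T & Complete T}.

Definition separable (T : topologicalType) : Prop :=
  exists2 D : set T, countable D & dense D.

Definition borel (T : ptopologicalType) := g_sigma_algebraType (@open T).

Definition cost (R : realType) (X : metricType R) (V : X -> R) (alpha A : R)
    (x y : X) : R :=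
  mdist x y `^ alpha * (A + V x + V y) `^ (1 - alpha).

(* A chain of length m is a map nat -> T of which only the values at 0, ..., m
   matter. For c >= 0 both infima are over nonempty sets bounded below by 0, so
   the real-valued [inf] is the genuine infimum. *)
Definition path_dist (R : realType) (T : Type) (c : T -> T -> R) (x y : T) : R :=
  inf [set inf [set \sum_(1 <= i < m.+1) c (z i.-1) (z i)
                 | z in [set z : nat -> T | z 0%N = x /\ z m = y]]
        | m in [set m : nat | (1 <= m)%N]].

Section wasserstein.
Context (R : realType) (disp : measure_display) (T : measurableType disp).

(* [T * T] carries the product sigma-algebra; on a separable metric space with
   its Borel sets this is the Borel sigma-algebra of the product. Measures are
   total set functions, so marginals are only compared on measurable sets. *)
Definition is_coupling (mu nu : probability T R)
    (G : probability (T * T)%type R) : Prop :=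
  forall B : set T, measurable B ->
    pushforward G fst B = mu B /\ pushforward G snd B = nu B.

Definition wasserstein (d : T -> T -> R) (mu nu : probability T R) : \bar R :=
  ereal_inf [set (\int[G]_z (d z.1 z.2)%:E)%E
              | G in [set G | is_coupling mu nu G]].

End wasserstein.

(* Main.v *)
(* The one-step chain gives d_{alpha,A} <= c_{alpha,A}. For any coupling G of mu
   and nu, Hoelder's inequality with exponents 1/alpha and 1/(1 - alpha) bounds
   the G-integral of the cost by
   (int psi dG)^alpha (int (A + V(x) + V(y)) dG)^(1 - alpha), and the last
   integral only depends on the marginals. Then take the infimum over G. *)
Require Import Defs.
From HB Require Import structures.
From mathcomp Require Import all_boot all_order all_algebra.
From mathcomp Require Import all_classical all_reals all_analysis.
From mathcomp Require Import measurable_realfun lra.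
Import Order.TTheory GRing.Theory Num.Theory.
Import numFieldNormedType.Exports.
Local Open Scope classical_set_scope.
Local Open Scope ring_scope.

Lemma open_mdist_ball (R : realFieldType) (X : metricType R) (p : X) (r : R) :
  open [set x | mdist p x < r].
Proof.
rewrite openE => x /= pxr; apply/nbhs_ballP.
exists (r - mdist p x); first by rewrite /= subr_gt0.
move=> y; rewrite ballEmdist /= ltrBrDl; apply: le_lt_trans.
exact: metric_triangle.
Qed.

(** This feeds a countable cover of the open set where the distance is below [r]: [p] ranges over
    [D] and [q] over the rationals. *)
Lemma dense_mdist_lt (R : realType) (X : metricType R) (D : set X) (x y : X) (r : R) :
    dense D -> mdist x y < r ->
  exists2 p, D p & exists q : rat, mdist p x < ratr q /\ mdist p y < r - ratr q.
Proof.
(* Half the slack, because the detour through [p] costs [mdist x p] twice: [mdist x p + mdist p y <=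
   2 * mdist x p + mdist x y < r]. *)
move=> dD xyr; pose e := (r - mdist x y) / 2.
have e0 : 0 < e by rewrite divr_gt0 ?subr_gt0.
have [|p [/= xp Dp]] := dD [set p | mdist x p < e] _ (open_mdist_ball _ _ _ _).
  by exists x => /=; rewrite mdistxx.
exists p => //.
have : mdist x p < r - mdist p y.
  rewrite ltrBrDr (le_lt_trans (lerD (lexx _) (metric_triangle p x y)))//.
  rewrite (metric_sym p x) addrA.
  by rewrite /e ltr_pdivlMr// in xp; lra.
move=> /rat_in_itvoo[q]; rewrite in_itv/= => /andP[xq qy].
by exists q; rewrite metric_sym; split => //; rewrite ltrBrDr addrC -ltrBrDr.
Qed.

Lemma measurable_open_borel (T : ptopologicalType) (U : set T) :
  open U -> measurable (U : set (borel T)).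
Proof. by move=> oU; exact: sub_sigma_algebra. Qed.

Lemma measurable_continuous_borel (R : realType) (T : ptopologicalType)
    (f : T -> R) :
  continuous f -> measurable_fun [set: borel T] f.
Proof.
move=> /continuousP cf; apply: (measurability _ (RGenOpens.measurableE R)).
move=> _ [_ [a [b ->] <-]]; rewrite setTI; apply: measurable_open_borel.
exact/cf/interval_open.
Qed.

(* Separability is what makes the metric measurable for the product
   sigma-algebra: {d < a} is a countable union of products of balls. *)
Lemma measurable_mdist (R : realType) (X : completeMetricType R) :
    separable X ->
  measurable_fun [set: (borel X * borel X)%type]
    (fun z : borel X * borel X => @mdist R X z.1 z.2).
Proof.
move=> [D cD dD]; apply: (measurability _ (RGenInftyO.measurableE R)).
move=> _ [_ [a ->] <-]; rewrite setTI preimage_itvNyo.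
pose B (p : X) (r : R) : set (borel X) := [set x | mdist p x < r].
have mB p r : measurable (B p r).
  exact: measurable_open_borel (open_mdist_ball _ _ _ _).
rewrite [X in measurable X](_ : _ = \bigcup_(p in D) \bigcup_(q : rat)
    (B p (ratr q) `*` B p (a - ratr q))); last first.
  apply/seteqP; split=> [[x y] /= xya|[x y] [p Dp [q _ [/= px py]]]].
    by have [p Dp [q [px py]]] := dense_mdist_lt _ _ _ _ _ _ dD xya; exists p => //;
      exists q.
  rewrite (le_lt_trans (metric_triangle x p y))//.
  by rewrite metric_sym -(subrKC (ratr q) a) ltrD.
have mF p : measurable (\bigcup_(q : rat) (B p (ratr q) `*` B p (a - ratr q))).
  by apply: bigcupT_measurable_rat => q; exact: measurableX.
rewrite bigcup_set_type; apply: countable_bigcupT_measurable.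
  by rewrite (eq_countable (card_setT D)).
by move=> p; exact: mF.
Qed.

(** The default value [inf set0 = 0] settles the empty case, so no chain has to be exhibited for
    lower bounds. *)
Lemma inf_ge0 (R : realType) (S : set R) : lbound S 0 -> 0 <= inf S.
Proof.
have [->|/set0P S0] := eqVneq S set0; first by rewrite inf0.
exact: lb_le_inf.
Qed.

Lemma path_dist_ge0 (R : realType) (T : Type) (c : T -> T -> R) (x y : T) :
  (forall x y, 0 <= c x y) -> 0 <= path_dist c x y.
Proof.
move=> c0; apply: inf_ge0 => _ [m _ <-].
by apply: inf_ge0 => _ [z _ <-]; exact: sumr_ge0.
Qed.

Lemma path_dist_le (R : realType) (T : Type) (c : T -> T -> R) (x y : T) :
  (forall x y, 0 <= c x y) -> path_dist c x y <= c x y.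
Proof.
move=> c0.
have S0 m : lbound [set \sum_(1 <= i < m.+1) c (z i.-1) (z i)
    | z in [set z : nat -> T | z 0%N = x /\ z m = y]] 0.
  by move=> _ [z _ <-]; exact: sumr_ge0.
apply: (@le_trans _ _ (inf [set \sum_(1 <= i < 2) c (z i.-1) (z i)
    | z in [set z : nat -> T | z 0%N = x /\ z 1%N = y]])).
  apply: ge_inf; last by exists 1%N.
  by exists 0 => _ [m _ <-]; apply: inf_ge0; exact: S0.
apply: ge_inf; first by exists 0; exact: S0.
(* The one-step chain, continued constantly by [y] past index 1. *)
exists (fun n => if n is 0%N then x else y) => //.
by rewrite big_nat1.
Qed.

(* The integral of a nonnegative function is a supremum over the simple
   functions below it, so no measurability is needed. *)
Lemma le_integral_ge0 d (T : measurableType d) (R : realType)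
    (mu : {measure set T -> \bar R}) (f g : T -> \bar R) :
    (forall x, 0 <= f x)%E -> (forall x, f x <= g x)%E ->
  (\int[mu]_x f x <= \int[mu]_x g x)%E.
Proof.
move=> f0 fg; have g0 x : (0 <= g x)%E by exact: le_trans (fg x).
rewrite !ge0_integralE// !patch_setT.
apply: ge_ereal_sup => _ [h hf <-]; apply: ereal_sup_ubound.
by exists h => // x; exact: le_trans (fg x).
Qed.

Lemma hoelder_powR d (T : measurableType d) (R : realType)
    (mu : {measure set T -> \bar R}) (f g : T -> R) (a : R) :
    0 < a -> a < 1 ->
    measurable_fun [set: T] f -> measurable_fun [set: T] g ->
    (forall x, 0 <= f x) -> (forall x, 0 <= g x) ->
  (\int[mu]_x (f x `^ a * g x `^ (1 - a))%:E <=
   (\int[mu]_x (f x)%:E) `^ a * (\int[mu]_x (g x)%:E) `^ (1 - a))%E.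
Proof.
move=> a0 a1 mf mg f0 g0.
have b0 : 0 < 1 - a by rewrite subr_gt0.
(* The outer exponent of the norm of order [1 / b] is [b], and its inner exponent cancels the power
   on [h]. Infinite integrals are allowed. *)
have powK (h : T -> R) (b : R) : 0 < b -> (forall x, 0 <= h x) ->
    Lnorm mu (b^-1)%:E (EFin \o (fun x => h x `^ b)) =
    ((\int[mu]_x (h x)%:E) `^ b)%E.
  move=> bgt0 h0; rewrite unlock invrK; congr (_ `^ _)%E.
  apply: eq_integral => x _ /=.
  by rewrite ger0_norm ?powR_ge0// -powRrM mulfV ?gt_eqF// powRr1.
rewrite -(powK f)// -(powK g)//.
apply: le_trans (hoelder mu _ _ _ _ _) => //; last 5 first.
- exact: (measurableT_comp (measurable_powR a)) mf.
- exact: (measurableT_comp (measurable_powR (1 - a))) mg.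
- by rewrite invr_gt0.
- by rewrite invr_gt0.
- by rewrite !invrK subrKC.
rewrite Lnorm1 [leRHS](eq_integral (fun x => (f x `^ a * g x `^ (1 - a))%:E))//.
by move=> x _ /=; rewrite ger0_norm// mulr_ge0 ?powR_ge0.
Qed.

(** Change of variables in the form supplied by [is_coupling]: agreement on measurable sets already
    determines the integral. *)
Lemma ge0_integral_pushforward_eq d1 d2 (T1 : measurableType d1)
    (T2 : measurableType d2) (R : realType) (phi : T1 -> T2)
    (m1 : {measure set T1 -> \bar R}) (m2 : {measure set T2 -> \bar R})
    (f : T2 -> R) :
    measurable_fun [set: T1] phi -> measurable_fun [set: T2] f ->
    (forall x, 0 <= f x) ->
    (forall B, measurable B -> pushforward m1 phi B = m2 B) ->
  (\int[m1]_z (f (phi z))%:E = \int[m2]_x (f x)%:E)%E.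
Proof.
move=> mphi mf f0 m12.
have mEf : measurable_fun [set: T2] (EFin \o f) by exact/measurable_EFinP.
rewrite -[LHS](ge0_integral_pushforward mphi m1 measurableT mEf); last first.
  by move=> x _; rewrite lee_fin.
by apply: eq_measure_integral => B mB _; exact: m12.
Qed.

Lemma integral_cost_le (R : realType) (X : completeMetricType R)
    (sepX : separable X) (V : X -> R) (V_ge0 : forall x, 0 <= V x)
    (cV : continuous V) (a A : R) (a0 : 0 < a) (a1 : a < 1) (A0 : 0 < A)
    (mu nu : probability (borel X) R)
    (G : probability (borel X * borel X)%type R) :
    is_coupling mu nu G ->
  (\int[G]_z (cost V a A z.1 z.2)%:E <=
   (A%:E + \int[mu]_x (V x)%:E + \int[nu]_x (V x)%:E) `^ (1 - a)
   * (\int[G]_z (@mdist R X z.1 z.2)%:E) `^ a)%E.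
Proof.
move=> cG.
have mV : measurable_fun [set: borel X] V by exact: measurable_continuous_borel.
have mV1 : measurable_fun [set: borel X * borel X] (fun z => V z.1).
  exact: measurableT_comp mV measurable_fst.
have mV2 : measurable_fun [set: borel X * borel X] (fun z => V z.2).
  exact: measurableT_comp mV measurable_snd.
(* The second Hoelder factor: [A] integrates to itself since [G] has mass 1, and each [V] term sees
   one marginal. *)
have <- : (\int[G]_z (A + V z.1 + V z.2)%:E =
    A%:E + \int[mu]_x (V x)%:E + \int[nu]_x (V x)%:E)%E.
  rewrite -(ge0_integral_pushforward_eq _ _ _ _ _ fst G mu V)//; last first.
    by move=> B mB; exact: (cG B mB).1.
  rewrite -(ge0_integral_pushforward_eq _ _ _ _ _ snd G nu V)//; last first.
    by move=> B mB; exact: (cG B mB).2.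
  under [LHS]eq_integral do rewrite 2!EFinD.
  rewrite ge0_integralD//=; last 4 first.
  - by move=> z _; rewrite -EFinD lee_fin addr_ge0// ltW.
  - by apply: emeasurable_funD => //; exact/measurable_EFinP.
  - by move=> z _; rewrite lee_fin.
  - exact/measurable_EFinP.
  rewrite ge0_integralD//=; last 3 first.
  - by move=> z _; rewrite lee_fin ltW.
  - by move=> z _; rewrite lee_fin.
  - exact/measurable_EFinP.
  by rewrite integral_cst//= probability_setT mule1.
rewrite muleC; apply: hoelder_powR => //.
- exact: measurable_mdist.
- by apply: measurable_funD => //; exact: measurable_funD.
- by move=> z; exact: mdist_ge0.
- by move=> z; rewrite !addr_ge0// ltW.
Qed.

Theorem theorem4 (R : realType) (X : completeMetricType R)
    (sepX : separable X)
    (V : X -> R) (V_ge0 : forall x, 0 <= V x) (cV : continuous V)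
    (alpha A : R) (alpha_gt0 : 0 < alpha) (alpha_lt1 : alpha < 1)
    (A_gt0 : 0 < A)
    (mu nu : probability (borel X) R)
    (muV : (\int[mu]_x (V x)%:E < +oo)%E)
    (nuV : (\int[nu]_x (V x)%:E < +oo)%E) :
  (@wasserstein R _ (borel X) (path_dist (cost V alpha A)) mu nu <=
   (A%:E + \int[mu]_x (V x)%:E + \int[nu]_x (V x)%:E) `^ (1 - alpha)
   * (@wasserstein R _ (borel X) (@mdist R X) mu nu) `^ alpha)%E.
Proof.
have c0 x y : 0 <= cost V alpha A x y by rewrite mulr_ge0 ?powR_ge0.
have Wle G : is_coupling mu nu G ->
    (@wasserstein R _ (borel X) (path_dist (cost V alpha A)) mu nu <=
     (A%:E + \int[mu]_x (V x)%:E + \int[nu]_x (V x)%:E) `^ (1 - alpha)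
     * (\int[G]_z (@mdist R X z.1 z.2)%:E) `^ alpha)%E.
  move=> cG; apply: le_trans (integral_cost_le _ _ sepX _ V_ge0 cV _ _
    alpha_gt0 alpha_lt1 A_gt0 _ _ _ cG).
  apply: ge_ereal_inf; eexists; first by exists G; [exact: cG|].
  (* [path_dist] has not been shown measurable, hence the purely pointwise comparison. *)
  apply: le_integral_ge0 => z; rewrite lee_fin; first exact: path_dist_ge0.
  exact: path_dist_le.
set W := wasserstein _ _ _ in Wle *.
have muV_ge0 : (0 <= \int[mu]_x (V x)%:E)%E.
  by apply: integral_ge0 => x _; rewrite lee_fin.
have nuV_ge0 : (0 <= \int[nu]_x (V x)%:E)%E.
  by apply: integral_ge0 => x _; rewrite lee_fin.
have W0 : (0 <= W)%E.
  apply/ereal_infP => _ [G _ <-]; apply: integral_ge0 => z _.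
  by rewrite lee_fin path_dist_ge0.
(* Finite moments make the factor real and [A > 0] makes it positive, so it can be divided out. *)
have [k k0 Kk] : exists2 k : R, 0 < k &
    ((A%:E + \int[mu]_x (V x)%:E + \int[nu]_x (V x)%:E) `^ (1 - alpha)
     = k%:E)%E.
  move: muV nuV muV_ge0 nuV_ge0.
  case: (integral mu _ _) => [m| |]//; case: (integral nu _ _) => [n| |]//.
  move=> _ _; rewrite !lee_fin => m0 n0.
  exists ((A + m + n) `^ (1 - alpha)) => //.
  by rewrite powR_gt0// -addrA ltr_wpDr// addr_ge0.
(* Raising to the power 1 / alpha moves the infimum over couplings out of the
   power without any appeal to continuity. *)
have kW0 : (0 <= (k^-1)%:E * W)%E by rewrite mule_ge0// lee_fin invr_ge0 ltW.
have kWle : (((k^-1)%:E * W) `^ alpha^-1 <=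
    @wasserstein R _ (borel X) (@mdist R X) mu nu)%E.
  apply/ereal_infP => _ [G cG <-].
  have I0 : (0 <= \int[G]_z (@mdist R X z.1 z.2)%:E)%E.
    by apply: integral_ge0 => z _; rewrite lee_fin; exact: mdist_ge0.
  (* Writing the integral as its power [alpha] raised to [1 / alpha] reduces the claim, by
     monotonicity, to [Wle]. *)
  rewrite -[leRHS]poweRe1// -(@mulfV _ alpha) ?gt_eqF// poweRrM.
  rewrite gt0_ler_poweR ?invr_ge0 ?(ltW alpha_gt0)// ?in_itv/= ?leey ?andbT ?poweR_ge0//.
  by rewrite lee_pdivrMl// -Kk; exact: Wle.
rewrite Kk -lee_pdivrMl// -[leLHS]poweRe1//.
rewrite -(@mulVf _ alpha) ?gt_eqF// poweRrM.
rewrite gt0_ler_poweR ?(ltW alpha_gt0)// ?in_itv/= ?leey ?andbT ?poweR_ge0//.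
(* The remaining side condition is that the Wasserstein distance for [mdist] is nonnegative. *)
exact: le_trans (poweR_ge0 _ _) kWle.
Qed.
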